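(* Let $\mu=\mu_m$ be the minimum probability of epoch $m\geq 1$ and let $H_t$ be the history at round $t=\tau_m$. The Coordinate Descent Algorithm (defined in the context), run on $H_t$ and $\mu_m$ with initial weights $Q_{\mathrm{init}}=\mathbf 0$, halts in at most $$\frac{4\ln(1/(K\mu_m))}{\mu_m}$$ iterations, and outputs a solution $Q$ to the optimization problem (OP).
   Context: Setting. $A$ is a finite set of $K$ actions, $X$ a space of contexts, $\Pi\subseteq A^X$ a finite nonempty set of policies. A history $H_t$ is a sequence of records $(x_i,a_i,r_i(a_i),p_i(a_i))\in X\times A\times[0,1]\times(0,1]$, $i=1,\dots,t$. Let $\widehat{\mathcal R}_t(\pi)=\frac1t\sum_{i=1}^t\frac{r_i(a_i)\mathbf 1\{\pi(x_i)=a_i\}}{p_i(a_i)}$, $\pi_t\in\arg\max_{\pi\in\Pi}\widehat{\mathcal R}_t(\pi)$, $\widehat{\mathrm{Reg}}_t(\pi)=\widehat{\mathcal R}_t(\pi_t)-\widehat{\mathcal R}_t(\pi)$, and let $\widehat{\mathbb E}_{x\sim H_t}$ denote expectation over $x$ uniform among $x_1,\dots,x_t$. For $\delta\in(0,1)$ and an epoch schedule $0=\tau_0<\tau_1<\cdots$ of integers, $\mu_m=\min\{\frac1{2K},\sqrt{\ln(16\tau_m^2|\Pi|/\delta)/(K\tau_m)}\}$. Weights. $\Delta^\Pi=\{Q\in\mathbb R^\Pi: Q(\pi)\ge0\ \forall\pi,\ \sum_\pi Q(\pi)\le1\}$. For non-negative $Q\in\mathbb R^\Pi$: $Q(a|x)=\sum_{\pi:\pi(x)=a}Q(\pi)$,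 $Q^\mu(a|x)=(1-K\mu)Q(a|x)+\mu$. (OP). With $b_\pi=\widehat{\mathrm{Reg}}_t(\pi)/(\psi\mu)$, $\psi=100$: find $Q\in\Delta^\Pi$ with $\sum_\pi Q(\pi)b_\pi\le2K$ and $\widehat{\mathbb E}_{x\sim H_t}[1/Q^{\mu}(\pi(x)|x)]\le2K+b_\pi$ for all $\pi\in\Pi$. Coordinate Descent Algorithm. Input $H_t$, $\mu$, $Q_{\mathrm{init}}\in\Delta^\Pi$. For each $\pi$ and $Q$ define $V_\pi(Q)=\widehat{\mathbb E}_{x\sim H_t}[1/Q^\mu(\pi(x)|x)]$, $S_\pi(Q)=\widehat{\mathbb E}_{x\sim H_t}[1/(Q^\mu(\pi(x)|x))^2]$, $D_\pi(Q)=V_\pi(Q)-(2K+b_\pi)$. Set $Q:=Q_{\mathrm{init}}$. Loop (each pass is one iteration): (i) if $\sum_\pi Q(\pi)(2K+b_\pi)>2K$, replace $Q$ by $cQ$ with $c=2K/\sum_\pi Q(\pi)(2K+b_\pi)$; (ii) if (for the current $Q$) there is a policy $\pi$ with $D_\pi(Q)>0$, pick any such $\pi$ and add $\alpha_\pi(Q)=\frac{V_\pi(Q)+D_\pi(Q)}{2(1-K\mu)S_\pi(Q)}$ to $Q(\pi)$, leaving all other weights unchanged; otherwise halt and output $Q$. *)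

(* Defs.v *)
From mathcomp Require Import all_boot all_order all_algebra finmap.
From mathcomp Require Import all_classical reals exp.

Set Implicit Arguments.
Unset Strict Implicit.
Unset Printing Implicit Defensive.

Import Order.TTheory GRing.Theory Num.Theory.

Local Open Scope ring_scope.

(* Record (x, a, r(a), p(a)); only the reward and the probability of the chosen
   action are stored. *)
Record observation (R : realType) (A : finType) (X : Type) := Observation {
  ctx : X;
  act : A;
  rew : R;
  prob : R;
  rew_bounds : 0 <= rew <= 1;
  prob_bounds : 0 < prob <= 1
}.

Definition history (R : realType) (A : finType) (X : Type) (t : nat) :=
  t.-tuple (observation R A X).

Definition epoch_schedule (tau : nat -> nat) :=
  tau 0%N = 0%N /\ (forall m, tau m < tau m.+1)%N.

Definition min_prob (R : realType) (A : finType) (X : Type)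
    (Pi : {fset (X -> A)}) (delta : R) (tau : nat -> nat) (m : nat) : R :=
  Num.min (1 / (2 * #|A|%:R))
    (Num.sqrt (ln (16 * (tau m)%:R ^+ 2 * #|` Pi|%:R / delta)
               / (#|A|%:R * (tau m)%:R))).

Section Defs.
Variables (R : realType) (A : finType) (X : Type) (Pi : {fset (X -> A)}).

Local Notation K := (#|A|%:R : R).

Implicit Types (Q : {ffun Pi -> R}) (pi : Pi) (x : X) (a : A).

Definition subdistribution Q :=
  (forall pi, 0 <= Q pi) /\ \sum_pi Q pi <= 1.

Definition cond_weight Q x a : R := \sum_(pi : Pi | fsval pi x == a) Q pi.

Definition smoothed (mu : R) Q x a : R := (1 - K * mu) * cond_weight Q x a + mu.

Section History.
Variables (t : nat) (H : history R A X t).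

Definition Ehat (f : X -> R) : R := t%:R^-1 * \sum_(i < t) f (ctx (tnth H i)).

Definition Rhat pi : R :=
  t%:R^-1 * \sum_(i < t) rew (tnth H i)
    * (fsval pi (ctx (tnth H i)) == act (tnth H i))%:R / prob (tnth H i).

Definition empirical_best (pit : Pi) := forall pi, Rhat pi <= Rhat pit.

(* pit stands for a chosen empirically best policy. *)
Variables (pit : Pi) (mu : R).

Definition Reghat pi : R := Rhat pit - Rhat pi.

Definition psi : R := 100.

Definition bhat pi : R := Reghat pi / (psi * mu).

Definition Vhat pi Q : R := Ehat (fun x => 1 / smoothed mu Q x (fsval pi x)).

Definition Shat pi Q : R := Ehat (fun x => 1 / smoothed mu Q x (fsval pi x) ^+ 2).

Definition Dhat pi Q : R := Vhat pi Q - (2 * K + bhat pi).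

Definition OP_solution Q :=
  [/\ subdistribution Q,
      \sum_pi Q pi * bhat pi <= 2 * K
    & forall pi, Vhat pi Q <= 2 * K + bhat pi].

Definition cd_cost Q : R := \sum_pi Q pi * (2 * K + bhat pi).

Definition cd_rescale Q : {ffun Pi -> R} :=
  if 2 * K < cd_cost Q then [ffun pi => 2 * K / cd_cost Q * Q pi] else Q.

Definition cd_alpha pi Q : R :=
  (Vhat pi Q + Dhat pi Q) / (2 * (1 - K * mu) * Shat pi Q).

Definition cd_update pi Q : {ffun Pi -> R} :=
  [ffun pi' => if pi' == pi then Q pi' + cd_alpha pi Q else Q pi'].

Inductive cd_state :=
  | Running of {ffun Pi -> R}
  | Halted of {ffun Pi -> R}.

(* One iteration of the loop. It is a relation, since any violating policy may
   be picked. The pass that detects halting also counts as an iteration. *)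
Inductive cd_pass Q : cd_state -> Prop :=
  | CdUpdate pi : 0 < Dhat pi (cd_rescale Q) ->
      cd_pass Q (Running (cd_update pi (cd_rescale Q)))
  | CdHalt : (forall pi, ~~ (0 < Dhat pi (cd_rescale Q))) ->
      cd_pass Q (Halted (cd_rescale Q)).

(* e n is the state after n iterations; a halted state is repeated forever. *)
Definition cd_execution (Qinit : {ffun Pi -> R}) (e : nat -> cd_state) :=
  e 0%N = Running Qinit /\
  forall n, match e n with
            | Running Q => cd_pass Q (e n.+1)
            | Halted Q => e n.+1 = Halted Q
            end.

Lemma cd_execution_exists (Qinit : {ffun Pi -> R}) :
  exists e, cd_execution Qinit e.
Proof.
pose next s := match s with
  | Running Q =>
      if [pick pi | 0 < Dhat pi (cd_rescale Q)] is Some pi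
      then Running (cd_update pi (cd_rescale Q)) else Halted (cd_rescale Q)
  | Halted Q => Halted Q
  end.
exists (fun n => iter n next (Running Qinit)); split=> // n.
rewrite iterS; case: (iter n next _) => [Q|Q] //=.
by case: pickP => [pi Dpi|noD]; constructor=> // pi; rewrite noD.
Qed.

End History.
End Defs.

(* Main.v *)
(* A potential argument. The potential, a relative entropy plus a linear cost, is
   nonnegative. Rescaling does not increase it: by [ln u - ln v <= u / v - 1] the
   logarithmic terms change by at most what the cost loses, the mean of
   [w / ((1 - K mu) w + mu)] over the actions being at most 1 by concavity. The step
   [alpha] minimizes the quadratic upper bound on the potential given by
   [ln (1 + y) >= y - y^2 / 2], and as [V > 2 K] and [mu S <= V] each update lowers
   the potential by at least [mu / (4 (1 - K mu))]. Initially the potential equals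
   [ln (1 / (K mu)) / (1 - K mu) - 1]; the term [-1] leaves room for the extra pass
   that detects halting. *)

Require Import Defs.
From mathcomp Require Import all_boot all_order all_algebra finmap.
From mathcomp Require Import all_classical reals exp.
From mathcomp Require Import topology normedtype derive ring lra.

Set Implicit Arguments.
Unset Strict Implicit.
Unset Printing Implicit Defensive.

Import Order.TTheory GRing.Theory Num.Theory.
Import numFieldNormedType.Exports.

Local Open Scope ring_scope.

(** * Logarithm inequalities *)

Lemma ge_ln1Dx2 (R : realType) (y : R) : 0 <= y -> y - y ^+ 2 / 2 <= ln (1 + y).
Proof.
move=> y_ge0; pose f (u : R) := ln (1 + u) - u + 2^-1 * u ^+ 2.
have f_der (u : R) : 0 <= u -> is_derive u 1 f ((1 + u)^-1 - 1 + u).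
  move=> u_ge0; have u1 : 0 < 1 + u by lra.
  have := is_derive1_ln u1 => ln_der.
  by rewrite /f; apply: is_derive_eq; rewrite /= /GRing.scale /=; lra.
have [||c] := @MVT_segment R f (fun u => (1 + u)^-1 - 1 + u) 0 y y_ge0.
- by move=> u; rewrite in_itv /= => /andP[/ltW /f_der].
- apply: derivable_within_continuous => u; rewrite in_itv /= => /andP[/f_der].
  by move=> ? _; apply: ex_derive.
rewrite in_itv /= => /andP[c_ge0 _]; rewrite /f addr0 ln1 expr0n /= mulr0 subr0.
rewrite !addr0 subr0.
(* The difference of the two sides vanishes at 0, and its derivative is this nonnegative
   fraction. *)
have -> : (1 + c)^-1 - 1 + c = c ^+ 2 / (1 + c) by field; lra.
move=> fy; have : 0 <= c ^+ 2 / (1 + c) * y.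
  by rewrite !mulr_ge0 ?invr_ge0 ?addr_ge0 ?sqr_ge0.
lra.
Qed.

Lemma lnB_le (R : realType) (u v : R) : 0 < u -> 0 < v -> ln u - ln v <= u / v - 1.
Proof.
move=> u_gt0 v_gt0; have uv : 0 < u / v by rewrite divr_gt0.
have uvE : 1 + (u / v - 1) = u / v by rewrite addrC subrK.
by rewrite -ln_div // -[X in ln X]uvE le_ln1Dx //; lra.
Qed.

Lemma lnB_ge (R : realType) (u v : R) : 0 < v -> v <= u ->
  (u / v - 1) - (u / v - 1) ^+ 2 / 2 <= ln u - ln v.
Proof.
move=> v_gt0 vu; have u_gt0 : 0 < u by apply: lt_le_trans vu.
have uvE : 1 + (u / v - 1) = u / v by rewrite addrC subrK.
by rewrite -ln_div // -[X in ln X]uvE ge_ln1Dx2 // subr_ge0 ler_pdivlMr ?mul1r.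
Qed.

(** * Empirical means over the contexts of the history *)

Section EmpiricalMean.
Variables (R : realType) (A : finType) (X : Type) (t : nat) (H : history R A X t).
Implicit Types f g : X -> R.

Lemma le_Ehat f g : (forall x, f x <= g x) -> Ehat H f <= Ehat H g.
Proof. by move=> fg; rewrite ler_wpM2l ?invr_ge0 // ler_sum. Qed.

Lemma EhatD f g : Ehat H (fun x => f x + g x) = Ehat H f + Ehat H g.
Proof. by rewrite /Ehat big_split mulrDr. Qed.

Lemma EhatZ (k : R) f : Ehat H (fun x => k * f x) = k * Ehat H f.
Proof. by rewrite /Ehat -mulr_sumr mulrCA. Qed.

Lemma Ehat_cst (k : R) : (0 < t)%N -> Ehat H (fun=> k) = k.
Proof.
move=> t_gt0; rewrite /Ehat sumr_const card_ord -[k *+ t]mulr_natl mulKf //.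
by rewrite pnatr_eq0 -lt0n.
Qed.

Lemma Ehat_gt0 f : (0 < t)%N -> (forall x, 0 < f x) -> 0 < Ehat H f.
Proof.
move=> t_gt0 f_gt0; rewrite mulr_gt0 ?invr_gt0 ?ltr0n //.
by rewrite (bigD1 (Ordinal t_gt0)) //= ltr_wpDr // sumr_ge0 // => i _; apply: ltW.
Qed.

End EmpiricalMean.

(** * Weights and smoothed probabilities *)

Section CoordinateDescent.
Variables (R : realType) (A : finType) (X : Type) (Pi : {fset (X -> A)}).
Variables (t : nat) (H : history R A X t) (pit : Pi) (mu : R).

Local Notation K := (#|A|%:R : R).

Hypotheses (t_gt0 : (0 < t)%N) (A_gt0 : (0 < #|A|)%N).
Hypotheses (pitP : empirical_best H pit).
Hypotheses (mu_gt0 : 0 < mu) (Kmu : 2 * (K * mu) <= 1).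

Implicit Types (Q : {ffun Pi -> R}) (pi : Pi) (x : X) (a : A).

Lemma K_ge1 : 1 <= K.
Proof. by rewrite ler1n. Qed.

Lemma smooth_factor_gt0 : 0 < 1 - K * mu.
Proof. by have := Kmu; lra. Qed.

Lemma bhat_ge0 pi : 0 <= bhat H pit mu pi.
Proof.
rewrite divr_ge0 ?subr_ge0 ?pitP // mulr_ge0 ?ltW //; exact: ler0n _ 100.
Qed.

Lemma cond_weight_ge0 Q x a : (forall pi, 0 <= Q pi) -> 0 <= cond_weight Q x a.
Proof. by move=> Q0; apply: sumr_ge0. Qed.

Lemma sum_cond_weight Q x : \sum_a cond_weight Q x a = \sum_pi Q pi.
Proof.
by rewrite [RHS](partition_big (fun pi : Pi => fsval pi x) predT).
Qed.

Lemma smoothed_ge Q x a : (forall pi, 0 <= Q pi) -> mu <= smoothed mu Q x a.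
Proof.
move=> Q0; rewrite lerDr mulr_ge0 ?cond_weight_ge0 //; exact/ltW/smooth_factor_gt0.
Qed.

Lemma smoothed_gt0 Q x a : (forall pi, 0 <= Q pi) -> 0 < smoothed mu Q x a.
Proof. by move=> Q0; apply: lt_le_trans (smoothed_ge x a Q0). Qed.

(* Equal to [E_x RE(uniform || Q^mu(.|x)) / (1 - K mu) + sum_pi Q(pi) b_pi / (2 K)],
   where RE (p || q) = sum_a (p_a ln (p_a / q_a) + q_a - p_a): the linear terms of
   RE are absorbed into the cost. *)
Definition potential Q : R :=
  cd_cost H pit mu Q / (2 * K) - 1
  - Ehat H (fun x => \sum_a ln (K * smoothed mu Q x a)) / (K * (1 - K * mu)).

(** * The potential: its sign and its change under the two steps of a pass *)

Lemma costE Q :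
  2 * K * \sum_pi Q pi + \sum_pi Q pi * bhat H pit mu pi = cd_cost H pit mu Q.
Proof.
rewrite /cd_cost mulr_sumr -big_split /=; apply: eq_bigr => pi _; ring.
Qed.

(** With [ln u <= u - 1], the normalized logarithmic term is at most [\sum_pi Q pi - 1]. Since
    [bhat] is nonnegative, the cost divided by [2 * K] is at least [\sum_pi Q pi], which compensates
    for it. *)
Lemma potential_ge0 Q : (forall pi, 0 <= Q pi) -> 0 <= potential Q.
Proof.
move=> Q0; have K1 := K_ge1; have s0 := smooth_factor_gt0.
have Ks0 : 0 < K * (1 - K * mu) by rewrite mulr_gt0 //; lra.
have logs : Ehat H (fun x => \sum_a ln (K * smoothed mu Q x a))
    <= K * (1 - K * mu) * (\sum_pi Q pi - 1).
  rewrite -[leRHS](Ehat_cst H) //; apply: le_Ehat => x.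
  apply: (@le_trans _ _ (\sum_a (K * smoothed mu Q x a - 1))).
    apply: ler_sum => a _; have q0 := smoothed_gt0 x a Q0.
    have := @lnB_le R (K * smoothed mu Q x a) 1; rewrite ln1 subr0 divr1; apply=> //.
    by rewrite mulr_gt0 //; lra.
  rewrite big_split /= sumr_const -mulr_sumr big_split /= sumr_const.
  rewrite -mulr_sumr sum_cond_weight le_eqVlt; apply/orP; left; apply/eqP; ring.
have bsum : 0 <= \sum_pi Q pi * bhat H pit mu pi.
  by apply: sumr_ge0 => pi _; rewrite mulr_ge0 ?bhat_ge0.
have cost := costE Q.
rewrite /potential -cost; move: logs.
rewrite mulrC -ler_pdivrMr // => logs.
have : \sum_pi Q pi <= (2 * K * \sum_pi Q pi + \sum_pi Q pi * bhat H pit mu pi) / (2 * K).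
  by rewrite ler_pdivlMr; lra.
lra.
Qed.

(** Rescaling brings the cost down to exactly [2 * K], so the cost term falls by [c^-1 - 1]. The
    normalized logarithmic term loses no more than that. *)
Lemma potential_rescale Q : (forall pi, 0 <= Q pi) ->
  potential (cd_rescale H pit mu Q) <= potential Q.
Proof.
move=> Q0; have K1 := K_ge1; have s0 := smooth_factor_gt0.
have K0 : 0 < K by lra.
rewrite /cd_rescale; case: ifP => // cost_gt.
set c := 2 * K / _; set Q' := finfun _.
have cost0 : 0 < cd_cost H pit mu Q by lra.
have c0 : 0 < c by rewrite divr_gt0 //; lra.
have c1 : c < 1 by rewrite ltr_pdivrMr ?mul1r.
have Q'0 pi : 0 <= Q' pi by rewrite ffunE mulr_ge0 // ltW.
have weightQ' x a : cond_weight Q' x a = c * cond_weight Q x a.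
  by rewrite mulr_sumr; apply: eq_bigr => pi _; rewrite ffunE.
have costQ' : cd_cost H pit mu Q' = 2 * K.
  transitivity (c * cd_cost H pit mu Q); last by rewrite divfK ?gt_eqF.
  by rewrite mulr_sumr; apply: eq_bigr => pi _; rewrite ffunE mulrA.
have sumQ'1 : \sum_pi Q' pi <= 1.
  have := costE Q'; rewrite costQ' => costE'.
  have bsum : 0 <= \sum_pi Q' pi * bhat H pit mu pi.
    by apply: sumr_ge0 => pi _; rewrite mulr_ge0 ?bhat_ge0.
  by rewrite -(ler_pM2l (_ : 0 < 2 * K)); lra.
have logs : Ehat H (fun x => \sum_a ln (K * smoothed mu Q x a))
    <= Ehat H (fun x => \sum_a ln (K * smoothed mu Q' x a))
       + (1 - K * mu) * (c^-1 - 1) * K.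
  rewrite -[X in _ + X](Ehat_cst H) // -EhatD; apply: le_Ehat => x.
  apply: (@le_trans _ _ (\sum_a (ln (K * smoothed mu Q' x a)
     + (1 - K * mu) * (c^-1 - 1) * (1 + K * mu * (K * cond_weight Q' x a - 1))))).
    apply: ler_sum => a _; rewrite -lerBlDl.
    have q0 := smoothed_gt0 x a Q0; have q'0 := smoothed_gt0 x a Q'0.
    apply: le_trans (lnB_le _ _) _; try by rewrite mulr_gt0.
    have w0 := cond_weight_ge0 x a Q'0.
    have weightQ : cond_weight Q x a = c^-1 * cond_weight Q' x a.
      by rewrite weightQ' mulKf ?gt_eqF.
    move: q'0; rewrite /smoothed weightQ; set w := cond_weight _ _ _ in w0 *.
    set q' := (1 - K * mu) * w + mu => q'0.
    have -> : K * ((1 - K * mu) * (c^-1 * w) + mu) / (K * q') - 1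
        = (1 - K * mu) * (c^-1 - 1) * (w / q').
      by rewrite /q'; field; rewrite !gt_eqF.
    rewrite ler_wpM2l //.
      by rewrite mulr_ge0 ?ltW // subr_gt0 invf_gt1.
    (* The right-hand side is the tangent at [w = 1 / K] of the concave [w / q']. *)
    rewrite ler_pdivrMr // -subr_ge0.
    have -> : (1 + K * mu * (K * w - 1)) * q' - w = (1 - K * mu) * mu * (K * w - 1) ^+ 2.
      by rewrite /q'; ring.
    by rewrite mulr_ge0 ?sqr_ge0 // mulr_ge0 // ltW.
  rewrite big_split /= lerD2l -mulr_sumr ler_wpM2l //.
    by rewrite mulr_ge0 ?ltW // subr_gt0 invf_gt1.
  (* The tangent bounds add up to [K + K ^+ 2 * mu * (\sum_pi Q' pi - 1)], at most [K] because the
     rescaled weights have total at most 1. *)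
  rewrite big_split /= sumr_const -mulr_sumr big_split /= sumr_const.
  rewrite -mulr_sumr sum_cond_weight.
  rewrite gerDl; have Kmu0 : 0 < K * mu by rewrite mulr_gt0.
  by rewrite pmulr_rle0 // -[-1 *+ _]mulr_natl mulrN1 subr_le0 ger_pMr.
rewrite /potential costQ'.
have -> : cd_cost H pit mu Q / (2 * K) = c^-1 by rewrite /c invf_div.
rewrite divff ?gt_eqF //; last lra.
have Ks0 : 0 < K * (1 - K * mu) by rewrite mulr_gt0.
move: logs; rewrite -(ler_pM2r (_ : 0 < (K * (1 - K * mu))^-1)) ?invr_gt0 //.
rewrite mulrDl.
have -> : (1 - K * mu) * (c^-1 - 1) * K / (K * (1 - K * mu)) = c^-1 - 1.
  by field; rewrite !gt_eqF.
lra.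
Qed.

(** The sign of [alpha] is part of the conclusion because the nonnegativity of the weights must
    survive the update. *)
Lemma potential_update Q pi : (forall pi, 0 <= Q pi) ->
  0 < Dhat H pit mu pi Q ->
  0 <= cd_alpha H pit mu pi Q /\
  potential (cd_update H pit mu pi Q) <= potential Q - mu / (4 * (1 - K * mu)).
Proof.
move=> Q0 D0; have K1 := K_ge1; have s0 := smooth_factor_gt0.
have K0 : 0 < K by lra.
have b0 := bhat_ge0 pi.
set V := Vhat H mu pi Q; set S := Shat H mu pi Q.
have VE : Dhat H pit mu pi Q = V - (2 * K + bhat H pit mu pi) by [].
have V0 : 2 * K < V by lra.
have SV : mu * S <= V.
  rewrite -EhatZ; apply: le_Ehat => x.
  have q0 := smoothed_gt0 x (fsval pi x) Q0.
  have muq := smoothed_ge x (fsval pi x) Q0.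
  set q := smoothed _ _ _ _ in q0 muq *.
  have -> : mu * (1 / q ^+ 2) = (mu / q) * (1 / q) by field; rewrite gt_eqF.
  by rewrite ger_pMl ?divr_gt0 // ler_pdivrMr ?mul1r.
have S0 : 0 < S.
  apply: Ehat_gt0 => // x; rewrite divr_gt0 ?exprn_gt0 //.
  exact: smoothed_gt0.
set al := cd_alpha _ _ _ _ _; set Q' := cd_update _ _ _ _ _.
have alE : al = (V + Dhat H pit mu pi Q) / (2 * (1 - K * mu) * S) by [].
have al0 : 0 < al.
  by rewrite alE; apply: divr_gt0; [lra|rewrite mulr_gt0 // mulr_gt0].
split; first exact: ltW.
have logs : Ehat H (fun x => \sum_a ln (K * smoothed mu Q x a))
    + ((1 - K * mu) * al * V - ((1 - K * mu) * al) ^+ 2 / 2 * S)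
    <= Ehat H (fun x => \sum_a ln (K * smoothed mu Q' x a)).
  rewrite -[- (_ * S)]mulNr /V /S /Vhat /Shat -!EhatZ -!EhatD; apply: le_Ehat => x.
  (* Only the action that [pi] chooses at [x] changes its probability, by [(1 - K * mu) * al]; the
     other logarithms cancel. *)
  rewrite (bigD1 (fsval pi x)) //= [leRHS](bigD1 (fsval pi x)) //=.
  have q0 := smoothed_gt0 x (fsval pi x) Q0.
  have weightQ' a : cond_weight Q' x a = cond_weight Q x a + al *+ (fsval pi x == a).
    rewrite /cond_weight; case: eqP => [pia|/eqP pia]; last first.
      rewrite addr0; apply: eq_bigr => pi' /eqP pi'a; rewrite ffunE.
      by case: eqP => // pi'E; rewrite -pi'a pi'E eqxx in pia.
    rewrite (bigD1 pi) ?pia //= [in RHS](bigD1 pi) ?pia //= ffunE eqxx mulr1n.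
    rewrite addrAC; congr (_ + _ + _).
    by apply: eq_bigr => pi' /andP[_ /negbTE pi'E]; rewrite ffunE pi'E.
  have -> : \sum_(a | a != fsval pi x) ln (K * smoothed mu Q' x a)
      = \sum_(a | a != fsval pi x) ln (K * smoothed mu Q x a).
    apply: eq_bigr => a; rewrite eq_sym => /negbTE api.
    by rewrite /smoothed weightQ' api addr0.
  have qE : smoothed mu Q' x (fsval pi x)
      = smoothed mu Q x (fsval pi x) + (1 - K * mu) * al.
    by rewrite /smoothed weightQ' eqxx mulr1n; ring.
  rewrite qE; set q := smoothed _ _ _ _ in q0 *.
  have sal0 : 0 < (1 - K * mu) * al by rewrite mulr_gt0.
  have := @lnB_ge R (K * (q + (1 - K * mu) * al)) (K * q).
  rewrite mulr_gt0 // ler_pM2l // => /(_ isT).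
  have -> : (q <= q + (1 - K * mu) * al) by lra.
  move=> /(_ isT).
  have -> : K * (q + (1 - K * mu) * al) / (K * q) - 1 = (1 - K * mu) * al / q.
    by field; rewrite !gt_eqF.
  have -> : ((1 - K * mu) * al / q) ^+ 2 / 2
      = ((1 - K * mu) * al) ^+ 2 / 2 * (1 / q ^+ 2) by field; rewrite !gt_eqF.
  rewrite !mul1r; lra.
have costQ' : cd_cost H pit mu Q' = cd_cost H pit mu Q + al * (V - Dhat H pit mu pi Q).
  rewrite /cd_cost (bigD1 pi) //= [in RHS](bigD1 pi) //= ffunE eqxx.
  rewrite (eq_bigr (fun pi' => Q pi' * (2 * K + bhat H pit mu pi'))); last first.
    by move=> pi' /negbTE pi'E; rewrite ffunE pi'E.
  rewrite VE -/al; ring.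
have Ks0 : 0 < K * (1 - K * mu) by rewrite mulr_gt0.
move: logs; rewrite -(ler_pM2r (_ : 0 < (K * (1 - K * mu))^-1)) ?invr_gt0 //.
rewrite mulrDl /potential costQ'.
set L := Ehat _ _ / _; set L' := Ehat _ _ / _.
clearbody V S; set D := Dhat _ _ _ _ _ in D0 VE alE *.
(* As [V - D] is the unit cost of [pi], the first summand is exactly the increase of the cost term;
   the second is the net decrease of the potential. *)
have -> : ((1 - K * mu) * al * V - ((1 - K * mu) * al) ^+ 2 / 2 * S)
    / (K * (1 - K * mu))
    = al * (V - D) / (2 * K) + (V + D) ^+ 2 / (8 * K * (1 - K * mu) * S).
  by rewrite alE; field; rewrite !gt_eqF.
have drop : mu / (4 * (1 - K * mu)) <= (V + D) ^+ 2 / (8 * K * (1 - K * mu) * S).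
  rewrite ler_pdivlMr; last by rewrite !mulr_gt0 // ltr0n.
  have -> : mu / (4 * (1 - K * mu)) * (8 * K * (1 - K * mu) * S) = 2 * K * (mu * S).
    by field; rewrite gt_eqF.
  (* One factor [V] dominates [2 * K], the other dominates [mu * S]. *)
  apply: (@le_trans _ _ (V * V)); first
    by apply: ler_pM => //; try lra; rewrite mulr_ge0 // ltW.
  by rewrite expr2; apply: ler_pM; lra.
rewrite mulrDl; lra.
Qed.

Lemma potential0 : potential [ffun=> 0] = ln (1 / (K * mu)) / (1 - K * mu) - 1.
Proof.
have K1 := K_ge1; have K0 : 0 < K by lra.
have s0 := smooth_factor_gt0.
have q0 x a : smoothed mu ([ffun=> 0] : {ffun Pi -> R}) x a = mu :> R.
  rewrite /smoothed /cond_weight big1 ?mulr0 ?add0r // => pi _; exact: ffunE.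
rewrite /potential /cd_cost big1 => [|pi _]; last by rewrite ffunE mul0r.
have -> : Ehat H (fun x => \sum_a ln (K * smoothed mu ([ffun=> 0] : {ffun Pi -> R}) x a))
    = K * ln (K * mu).
  rewrite -[RHS](Ehat_cst H) //; congr (Ehat H _); apply: funext => x.
  under eq_bigr do rewrite q0.
  by rewrite sumr_const -[LHS]mulr_natl.
by rewrite div1r lnV ?posrE ?mulr_gt0 //; field; rewrite !gt_eqF.
Qed.

(** * Feasibility at halting and the iteration count *)

Lemma cd_rescale_ge0 Q : (forall pi, 0 <= Q pi) ->
  forall pi, 0 <= cd_rescale H pit mu Q pi.
Proof.
move=> Q0 pi; rewrite /cd_rescale; case: ifP => // cost_gt; rewrite ffunE.
have := K_ge1 => K1; rewrite mulr_ge0 // divr_ge0 //; lra.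
Qed.

Lemma cd_rescale_cost Q : cd_cost H pit mu (cd_rescale H pit mu Q) <= 2 * K.
Proof.
have K1 := K_ge1; rewrite /cd_rescale; case: ltP => // cost_gt.
set c := _ / _; suff -> : cd_cost H pit mu [ffun pi => c * Q pi] = c * cd_cost H pit mu Q.
  by rewrite divfK // gt_eqF //; lra.
by rewrite mulr_sumr; apply: eq_bigr => pi _; rewrite ffunE mulrA.
Qed.

(** The cost bound after rescaling is a sum of two nonnegative terms, and so yields both the total
    weight bound and the regret constraint. The failed search for a violating policy is the
    remaining constraint. *)
Lemma halted_OP_solution Q : (forall pi, 0 <= Q pi) ->
  (forall pi, ~~ (0 < Dhat H pit mu pi (cd_rescale H pit mu Q))) ->
  OP_solution H pit mu (cd_rescale H pit mu Q).
Proof.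
move=> Q0 noD; have K1 := K_ge1; have cost_le := cd_rescale_cost Q.
move: noD (cd_rescale_ge0 Q0) cost_le; move: (cd_rescale _ _ _ _) => {Q0}Q noD Q0.
have bsum : 0 <= \sum_pi Q pi * bhat H pit mu pi.
  by apply: sumr_ge0 => pi _; rewrite mulr_ge0 ?bhat_ge0.
have Qsum : 0 <= \sum_pi Q pi by apply: sumr_ge0.
have KQsum : 0 <= 2 * K * \sum_pi Q pi by rewrite !mulr_ge0.
rewrite -costE => cost_le; split.
- split=> //; rewrite -(ler_pM2l (_ : 0 < 2 * K)); lra.
- lra.
- by move=> pi; move: (noD pi); rewrite -leNgt subr_le0.
Qed.

Lemma running_bound (n : nat) Q : (forall pi, 0 <= Q pi) ->
  potential Q + n%:R * (mu / (4 * (1 - K * mu))) <= potential [ffun=> 0] ->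
  n.+1%:R <= 4 * ln (1 / (K * mu)) / mu.
Proof.
move=> /potential_ge0 Phi_ge0 Phi_le; have s0 := smooth_factor_gt0.
have K1 := K_ge1; have mu_le : mu <= K * mu by rewrite ler_pMl.
have : n%:R * (mu / (4 * (1 - K * mu))) <= potential [ffun=> 0] by lra.
rewrite potential0 -(ler_pM2r (_ : 0 < 4 * (1 - K * mu))); last by lra.
have -> : n%:R * (mu / (4 * (1 - K * mu))) * (4 * (1 - K * mu)) = n%:R * mu.
  by field; rewrite gt_eqF.
have -> : (ln (1 / (K * mu)) / (1 - K * mu) - 1) * (4 * (1 - K * mu))
    = 4 * ln (1 / (K * mu)) - 4 * (1 - K * mu).
  by move: (ln _) => L; field; rewrite gt_eqF.
(* The extra iteration costs [mu], and [mu <= K * mu <= 1 / 2] is below [4 * (1 - K * mu)], the room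
   left by the term [-1] of the initial potential. *)
rewrite ler_pdivlMr // -natr1 => le_n.
have := Kmu; lra.
Qed.

(** The first alternative does not mention [n], so the induction carries it along unchanged once the
    run has halted. *)
Lemma execution_invariant (e : nat -> cd_state R Pi) (n : nat) :
  cd_execution H pit mu [ffun=> 0] e ->
  (exists (k : nat) Q, [/\ k%:R <= 4 * ln (1 / (K * mu)) / mu,
      e k = Halted Q & OP_solution H pit mu Q]) \/
  (exists Q, [/\ e n = Running Q, forall pi, 0 <= Q pi &
      potential Q + n%:R * (mu / (4 * (1 - K * mu))) <= potential [ffun=> 0]]).
Proof.
move=> [e0 eS]; elim: n => [|n [|[Q [en Q0 Phi_le]]]]; [right|by left|].
  by exists [ffun=> 0]; split=> // [pi|]; rewrite ?ffunE // mul0r addr0.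
have := eS n; rewrite en => pass; move en1: (e n.+1) pass => s pass.
case: pass en1 => [pi D0|noD] en1.
  have Q'0 := cd_rescale_ge0 Q0; have [al0 Phi_upd] := potential_update Q'0 D0.
  right; exists (cd_update H pit mu pi (cd_rescale H pit mu Q)); split=> //.
    by move=> pi'; rewrite ffunE; case: ifP => // _; rewrite addr_ge0.
  have := potential_rescale Q0; rewrite -natr1 mulrDl mul1r; lra.
left; exists n.+1, (cd_rescale H pit mu Q); split=> //.
  exact: running_bound Phi_le.
exact: halted_OP_solution.
Qed.

Lemma execution_halts (e : nat -> cd_state R Pi) :
  cd_execution H pit mu [ffun=> 0] e ->
  exists (n : nat) Q, [/\ n%:R <= 4 * ln (1 / (K * mu)) / mu,
    e n = Halted Q & OP_solution H pit mu Q].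
Proof.
move=> eP; pose B := 4 * ln (1 / (K * mu)) / mu.
(* A run still active after [Num.bound B] passes would force [Num.bound B + 1 <= B], against the
   Archimedean bound. *)
have [//|[Q [_ Q0 /(running_bound Q0) nB]]] :=
  execution_invariant (Num.bound B) eP.
have B_ge0 : 0 <= B by apply: le_trans nB; exact: ler0n.
by move: nB (archi_boundP B_ge0); rewrite -/B -natr1 => nB ltB; exfalso; lra.
Qed.

End CoordinateDescent.

(** * Specialization to the minimum probability of an epoch *)

Theorem theorem3 (R : realType) (A : finType) (X : Type)
    (Pi : {fset (X -> A)}) (Pi_neq0 : Pi != fset0)
    (delta : R) (delta_gt0 : 0 < delta) (delta_lt1 : delta < 1)
    (tau : nat -> nat) (tauP : epoch_schedule tau)
    (m : nat) (m_ge1 : (1 <= m)%N)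
    (H : history R A X (tau m))
    (pit : Pi) (pitP : empirical_best H pit) :
  let mu := min_prob Pi delta tau m in
  forall e : nat -> cd_state R Pi,
    cd_execution H pit mu [ffun => 0] e ->
    exists (n : nat) (Q : {ffun Pi -> R}),
      [/\ n%:R <= 4 * ln (1 / (#|A|%:R * mu)) / mu,
          e n = Halted Q
        & OP_solution H pit mu Q].
Proof.
move=> mu e eP; have [tau0 tauS] := tauP.
have t_gt0 : (0 < tau m)%N by rewrite -(prednK m_ge1); apply: leq_ltn_trans (tauS m.-1).
(* The history is nonempty, and its first record supplies an action. *)
have A_gt0 : (0 < #|A|)%N.
  by apply/card_gt0P; exists (act (tnth H (Ordinal t_gt0))).
have K0 : 0 < #|A|%:R :> R by rewrite ltr0n.
have t1 : 1 <= (tau m)%:R :> R by rewrite ler1n.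
have Pi1 : 1 <= #|` Pi|%:R :> R by rewrite ler1n cardfs_gt0.
apply: execution_halts => //.
(* For [0 < mu], the square root must be positive: the argument of its logarithm exceeds 1, as
   [delta < 1]. *)
- rewrite lt_min divr_gt0 ?mulr_gt0 //= sqrtr_gt0 divr_gt0 ?mulr_gt0 ?ltr0n //.
  apply: ln_gt0; rewrite ltr_pdivlMr // mul1r.
  have : 1 <= (tau m)%:R ^+ 2 * #|` Pi|%:R :> R.
    by rewrite mulr_ege1 // exprn_ege1.
  by rewrite -[16 * _ * _]mulrA; lra.
- have : mu <= 1 / (2 * #|A|%:R) by rewrite ge_min lexx.
  by rewrite ler_pdivlMr ?mulr_gt0 // => ?; lra.
Qed.
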